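(* Consider the consistent linear system $Ax=b$, where the coefficient matrix $A\in\mathbb{R}^{m\times n}$ and $b\in\mathbb{R}^m$. Let $x^{(0)}\in\mathbb{R}^n$ be an arbitrary initial approximation, and let $\tilde{x}$ be a solution of $Ax=b$ such that $P_{N(A)}(\tilde{x})=P_{N(A)}(x^{(0)})$. Then the iteration sequence $\{x^{(k)}\}_{k=1}^{\infty}$ generated by the MWRKO method obeys $$\|x^{(k)}-\tilde{x}\|^2\leq \prod_{s=0}^{k-1}\rho_s\,\|x^{(0)}-\tilde{x}\|^2,$$ where $$\rho_0=1-\frac{\lambda_{\min}(A^TA)}{\|A\|_F^2},\qquad \rho_1=1-\frac{\lambda_{\min}(A^TA)}{\Delta\cdot\gamma_1},\qquad \rho_k=1-\frac{\lambda_{\min}(A^TA)}{\Delta\cdot\gamma_2}\quad(\forall k>1),$$ with $$\gamma_1=\max_{1\le i\le m}\sum_{\substack{s=1\\ s\ne i}}^m\|a_s\|^2,\qquad \gamma_2=\max_{\substack{1\le i,j\le m\\ i\ne j}}\sum_{\substack{s=1\\ s\ne i,j}}^m\|a_s\|^2,\qquad \Delta=\max_{j\neq k}\sin^2\langle a_j,a_k\rangle\ (\in(0,1]),$$ where in the definition of $\Delta$ the symbol $\langle a_j,a_k\rangle$ denotes the angle between $a_j$ and $a_k$. In addition, if $x^{(0)}\in R(A^T)$, the sequence $\{x^{(k)}\}_{k=1}^{\infty}$ converges to the least-norm solution of $Ax=b$, i.e. $\lim_{k\to\infty}x^{(k)}=x^*=A^\dagger b$.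
   Context: Notation: $a_i^T$ is the $i$th row of $A$ (so $a_i\in\mathbb{R}^n$), $b_i$ the $i$th entry of $b$; $\|\cdot\|$ is the Euclidean norm, $\|\cdot\|_F$ the Frobenius norm; $\langle\cdot,\cdot\rangle$ is the scalar product (except in the definition of $\Delta$, where it denotes an angle, so that $\sin^2\langle a_j,a_k\rangle = 1-\frac{(a_j^Ta_k)^2}{\|a_j\|^2\|a_k\|^2}$); $R(\cdot)$ and $N(\cdot)$ are the range space and null space; $P_C(x)$ is the orthogonal projection of $x$ onto $C$; $A^\dagger$ is the Moore-Penrose pseudoinverse; $\lambda_{\min}(G)$ is the smallest nonzero eigenvalue of $G$. MWRKO method (maximal weighted residual Kaczmarz method with oblique projection): given $A$, $b$, $x^{(0)}$, set $M(i)=\|a_i\|^2$ for $i=1,\dots,m$. If several indices attain a maximum below, any one of them is selected at random. Initial step: compute $i_1=\arg\max_{1\le i\le m}\frac{|a_i^Tx^{(0)}-b_i|}{\|a_i\|}$ and $x^{(1)}=x^{(0)}+\frac{b_{i_1}-\langle a_{i_1},x^{(0)}\rangle}{M(i_1)}a_{i_1}$. For $k=1,2,\dots$ (in practice up to a prescribed number of steps): (1) Compute $i_{k+1}=\arg\max_{1\le i\le m}\frac{|a_i^Tx^{(k)}-b_i|}{\|a_i\|}$. (2) Compute $D_{i_k}=\langle a_{i_k},a_{i_{k+1}}\rangle$ and $r_{i_{k+1}}^{(k)}=b_{i_{k+1}}-\langle a_{i_{k+1}},x^{(k)}\rangle$. (3) Compute $w^{(i_k)}=a_{i_{k+1}}-\frac{D_{i_k}}{M(i_k)}a_{i_k}$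 and $h_{i_k}=\|w^{(i_k)}\|^2=M(i_{k+1})-\frac{D_{i_k}}{M(i_k)}D_{i_k}$. (4) Set $\alpha_{i_k}^{(k)}=r_{i_{k+1}}^{(k)}/h_{i_k}$ and $x^{(k+1)}=x^{(k)}+\alpha_{i_k}^{(k)}w^{(i_k)}$.
   Formalization: The bound is stated for k such that none of x^(0),...,x^(k-1) solves Ax=b (after an exact iterate x^(k)=x̃, but the product may be negative); Δ>0 is claimed only when rank A>1, since Δ=0 for parallel rows; rows of A are assumed nonzero. *)

(* Defs.v *)
From HB Require Import structures.
From mathcomp Require Import all_boot all_order all_algebra.
From mathcomp Require Import all_classical all_reals all_analysis.

Set Implicit Arguments.
Unset Strict Implicit.
Unset Printing Implicit Defensive.

Import Order.TTheory GRing.Theory Num.Theory.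
Import numFieldNormedType.Exports.

Local Open Scope classical_set_scope.
Local Open Scope ring_scope.

Section LinearAlgebra.
Variable R : realType.

Definition dotp n (u v : 'cV[R]_n) : R := (u^T *m v) 0 0.

(* MathComp's own norm on matrices is the max norm. *)
Definition enorm n (u : 'cV[R]_n) : R := Num.sqrt (dotp u u).

Definition frobnorm m n (A : 'M[R]_(m, n)) : R :=
  Num.sqrt (\sum_i \sum_j A i j ^+ 2).

Definition nullspace m n (A : 'M[R]_(m, n)) : set 'cV[R]_n :=
  [set x | A *m x = 0].

Definition rangespace m n (A : 'M[R]_(m, n)) : set 'cV[R]_m :=
  range (fun y : 'cV[R]_n => A *m y).

(* Orthogonal projection onto a linear subspace C: the unique p in C such that
   x - p is orthogonal to C. *)
Definition orthproj n (C : set 'cV[R]_n) (x : 'cV[R]_n) : 'cV[R]_n :=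
  xget 0 [set p | C p /\ forall y, C y -> dotp (x - p) y = 0].

Definition penrose m n (A : 'M[R]_(m, n)) (X : 'M[R]_(n, m)) : Prop :=
  [/\ A *m X *m A = A, X *m A *m X = X,
      (A *m X)^T = A *m X & (X *m A)^T = X *m A].

(* The Moore-Penrose pseudoinverse: the unique X satisfying [penrose A X]. *)
Definition mp_pinv m n (A : 'M[R]_(m, n)) : 'M[R]_(n, m) :=
  xget 0 [set X | penrose A X].

(* Smallest nonzero eigenvalue; it exists whenever G is a nonzero real
   symmetric matrix, in particular for G = A^T A with A nonzero. *)
Definition lambda_min n (G : 'M[R]_n) : R :=
  xget 0 [set l | [/\ l != 0, eigenvalue G l &
                      forall l', l' != 0 -> eigenvalue G l' -> l <= l']].

Definition least_norm_solution m n (A : 'M[R]_(m, n)) (b : 'cV[R]_m)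
    (x : 'cV[R]_n) : Prop :=
  A *m x = b /\ forall y : 'cV[R]_n, A *m y = b -> enorm x <= enorm y.

End LinearAlgebra.

Section MWRKO.
Variables (R : realType) (m n : nat) (A : 'M[R]_(m, n)).

Definition arow (i : 'I_m) : 'cV[R]_n := (row i A)^T.

(* Squared sine of the angle between two rows. *)
Definition sin2 (j k : 'I_m) : R :=
  1 - dotp (arow j) (arow k) ^+ 2
      / (enorm (arow j) ^+ 2 * enorm (arow k) ^+ 2).

(* All the quantities maximized below are nonnegative, so starting the maxima
   at 0 is harmless. *)
Definition mwrko_gamma1 : R :=
  \big[Num.max/0]_(i < m) \sum_(s < m | s != i) enorm (arow s) ^+ 2.

Definition mwrko_gamma2 : R :=
  \big[Num.max/0]_(p : 'I_m * 'I_m | p.1 != p.2)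
    \sum_(s < m | (s != p.1) && (s != p.2)) enorm (arow s) ^+ 2.

Definition mwrko_Delta : R :=
  \big[Num.max/0]_(p : 'I_m * 'I_m | p.1 != p.2) sin2 p.1 p.2.

Definition mwrko_rho (k : nat) : R :=
  let lam := lambda_min (A^T *m A) in
  match k with
  | 0 => 1 - lam / frobnorm A ^+ 2
  | 1 => 1 - lam / (mwrko_Delta * mwrko_gamma1)
  | _ => 1 - lam / (mwrko_Delta * mwrko_gamma2)
  end.

Variable b : 'cV[R]_m.

(* [mwrko x i]: the iterates x 0, x 1, ... and the row indices i 1, i 2, ...
   form a run of the method; ties in the argmax may be broken in any way, and
   i 0 is never used.  For a consistent system with nonzero rows, the divisor h
   can vanish only when x k already solves the system; then r = 0 as well, and
   0 / 0 = 0 leaves the iterate unchanged. *)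
Record mwrko (x : nat -> 'cV[R]_n) (i : nat -> 'I_m) : Prop := MWRKO {
  mwrko_argmax : forall k (j : 'I_m),
    `|dotp (arow j) (x k) - b j 0| / enorm (arow j) <=
    `|dotp (arow (i k.+1)) (x k) - b (i k.+1) 0| / enorm (arow (i k.+1));
  mwrko_init :
    x 1%N = x 0%N + ((b (i 1%N) 0 - dotp (arow (i 1%N)) (x 0%N))
                       / enorm (arow (i 1%N)) ^+ 2) *: arow (i 1%N);
  mwrko_step : forall k, (0 < k)%N ->
    let M j := enorm (arow j) ^+ 2 in
    let D := dotp (arow (i k)) (arow (i k.+1)) in
    let r := b (i k.+1) 0 - dotp (arow (i k.+1)) (x k) in
    let w := arow (i k.+1) - (D / M (i k)) *: arow (i k) in
    let h := enorm w ^+ 2 in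
    x k.+1 = x k + (r / h) *: w }.

End MWRKO.

(* Main.v *)
(** From step 1 on, each iterate satisfies the equation of the last row used,
    and from step 2 on those of the last two rows.  Hence a step subtracts from
    the squared error r^2 / h, where h = |a_j|^2 sin^2 <= Delta |a_j|^2 and
    r^2 / |a_j|^2 is the largest weighted squared residual, which is at least
    |A e|^2 divided by the sum of |a_s|^2 over the rows not known to be
    satisfied.  The errors e stay orthogonal to N(A), where
    |A e|^2 >= lambda_min(A^T A) |e|^2: a minimizer of the Rayleigh quotient on
    the unit sphere of N(A)^perp is an eigenvector, and every eigenvector for a
    nonzero eigenvalue lies in N(A)^perp. *)

Require Import Defs.
From HB Require Import structures.
From mathcomp Require Import all_boot all_order all_algebra.
From mathcomp Require Import all_classical all_reals all_analysis.
From mathcomp Require Import ring lra.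

Set Implicit Arguments.
Unset Strict Implicit.
Unset Printing Implicit Defensive.

Import Order.TTheory GRing.Theory Num.Theory.
Import numFieldNormedType.Exports.

Local Open Scope classical_set_scope.
Local Open Scope ring_scope.

(** * Euclidean inner product and norm on column vectors *)

Section InnerProduct.
Variable R : realType.
Implicit Types (m n : nat).

Lemma dotpE n (u v : 'cV[R]_n) : dotp u v = \sum_i u i 0 * v i 0.
Proof. by rewrite /dotp mxE; apply: eq_bigr => j _; rewrite !mxE. Qed.

Lemma dotpC n (u v : 'cV[R]_n) : dotp u v = dotp v u.
Proof. by rewrite !dotpE; apply: eq_bigr => j _; rewrite mulrC. Qed.

Lemma dotpDl n (u v w : 'cV[R]_n) : dotp (u + v) w = dotp u w + dotp v w.
Proof. by rewrite /dotp linearD mulmxDl mxE. Qed.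

Lemma dotpZl n a (u w : 'cV[R]_n) : dotp (a *: u) w = a * dotp u w.
Proof. by rewrite /dotp linearZ -scalemxAl mxE. Qed.

Lemma dotpBl n (u v w : 'cV[R]_n) : dotp (u - v) w = dotp u w - dotp v w.
Proof. by rewrite -scaleN1r dotpDl dotpZl mulN1r. Qed.

Lemma dotpDr n (u v w : 'cV[R]_n) : dotp w (u + v) = dotp w u + dotp w v.
Proof. by rewrite !(dotpC w) dotpDl. Qed.

Lemma dotpZr n a (u w : 'cV[R]_n) : dotp w (a *: u) = a * dotp w u.
Proof. by rewrite !(dotpC w) dotpZl. Qed.

Lemma dotpBr n (u v w : 'cV[R]_n) : dotp w (u - v) = dotp w u - dotp w v.
Proof. by rewrite !(dotpC w) dotpBl. Qed.

Lemma dotp0r n (u : 'cV[R]_n) : dotp u 0 = 0.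
Proof. by rewrite /dotp mulmx0 mxE. Qed.

Lemma dotp_ge0 n (u : 'cV[R]_n) : 0 <= dotp u u.
Proof. by rewrite dotpE; apply: sumr_ge0 => j _; rewrite -expr2 sqr_ge0. Qed.

Lemma dotp_eq0 n (u : 'cV[R]_n) : (dotp u u == 0) = (u == 0).
Proof.
apply/eqP/eqP => [|->]; last by rewrite dotp0r.
rewrite dotpE => /eqP; rewrite psumr_eq0 => [/allP u0|j _]; last first.
  by rewrite -expr2 sqr_ge0.
apply/matrixP => j k; rewrite ord1 mxE; apply/eqP.
by have /implyP := u0 j (mem_index_enum _); rewrite mulf_eq0 orbb; apply.
Qed.

Lemma dotp_gt0 n (u : 'cV[R]_n) : (0 < dotp u u) = (u != 0).
Proof. by rewrite lt_def dotp_ge0 andbT dotp_eq0. Qed.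

Lemma enorm_ge0 n (u : 'cV[R]_n) : 0 <= enorm u.
Proof. exact: sqrtr_ge0. Qed.

Lemma sqr_enorm n (u : 'cV[R]_n) : enorm u ^+ 2 = dotp u u.
Proof. by rewrite sqr_sqrtr ?dotp_ge0. Qed.

Lemma dotp_mulmx m n (B : 'M[R]_(m, n)) u v :
  dotp (B *m u) v = dotp u (B^T *m v).
Proof. by rewrite /dotp trmx_mul mulmxA. Qed.

Lemma coord_le_enorm n (u : 'cV[R]_n) j : `|u j 0| <= enorm u.
Proof.
rewrite -(@ler_pXn2r _ 2%N) ?nnegrE ?enorm_ge0 // sqr_enorm dotpE.
rewrite real_normK ?num_real // (bigD1 j) //= expr2 lerDl.
by apply: sumr_ge0 => l _; rewrite -expr2 sqr_ge0.
Qed.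

(** Carries Euclidean estimates over to the library topology, which comes from the max norm. *)
Lemma mx_norm_le_enorm n (u : 'cV[R]_n) : `|u| <= enorm u.
Proof.
rewrite [`|u|]mx_normrE; apply: bigmax_le => [|[j k] _ /=]; first exact: enorm_ge0.
by rewrite ord1 coord_le_enorm.
Qed.

Lemma continuous_mulmx_coord n p (B : 'M[R]_(n, p)) j :
  continuous (fun u : 'rV[R]_n => (u *m B) 0 j).
Proof.
rewrite (_ : (fun _ => _) = fun u : 'rV[R]_n => \sum_k u 0 k * B k j); last first.
  by apply/funext => u; rewrite mxE.
apply: continuous_big => [|k _ u]; first exact: add_continuous.
apply: (@continuousM _ _ (fun v : 'rV[R]_n => v 0 k) (fun=> B k j)).
  exact: coord_continuous.
exact: cst_continuous.
Qed.

(** Serves the extreme value theorem twice: [B := A] gives the objective, [B := 1] the constraint of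
    unit length. *)
Lemma continuous_dotp_mulmx m n (B : 'M[R]_(m, n)) :
  continuous (fun u : 'rV[R]_n => dotp (B *m u^T) (B *m u^T)).
Proof.
rewrite (_ : (fun _ => _) = fun u : 'rV[R]_n =>
    \sum_j (u *m B^T) 0 j * (u *m B^T) 0 j); last first.
  apply/funext => u; rewrite dotpE; apply: eq_bigr => j _.
  by rewrite -[B *m u^T]trmxK trmx_mul trmxK mxE.
apply: continuous_big => [|j _ u]; first exact: add_continuous.
apply: (@continuousM _ _ (fun v : 'rV[R]_n => (v *m B^T) 0 j)
  (fun v : 'rV[R]_n => (v *m B^T) 0 j));
  exact: continuous_mulmx_coord.
Qed.

End InnerProduct.

(** * Existence of the Moore-Penrose pseudoinverse *)

Section Penrose.
Variable R : realType.

Lemma gram_eq0 m n p (A : 'M[R]_(m, n)) (B : 'M[R]_(n, p)) :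
  A^T *m A *m B = 0 -> A *m B = 0.
Proof.
move=> AB0; apply/matrixP => j k; rewrite mxE [RHS]mxE.
have : col k (A *m B) == 0.
  rewrite -dotp_eq0 colE -mulmxA dotp_mulmx !mulmxA.
  by rewrite AB0 mul0mx dotp0r.
by move=> /eqP/matrixP/(_ j 0); rewrite !mxE.
Qed.

(** By [gram_eq0], A^T A and A have the same kernel, hence the same row space. *)
Lemma gram_factor m n (A : 'M[R]_(m, n)) : exists K, A = K *m (A^T *m A).
Proof.
apply/submxP; rewrite submxE; apply/eqP/gram_eq0.
by rewrite mulmx_coker.
Qed.

Lemma penrose_exists m n (A : 'M[R]_(m, n)) : exists X, penrose A X.
Proof.
(* From B = K B^T B, the matrix B K^T = K B^T B K^T is symmetric, so B K^T B = (B K^T)^T B = K B^T B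
   = B. *)
have inv13 p q (B : 'M[R]_(p, q)) :
    exists Y, B *m Y *m B = B /\ (B *m Y)^T = B *m Y.
  have [K BK] := gram_factor B.
  have KB : B *m K^T = K *m (B^T *m B) *m K^T by rewrite -BK.
  have sKB : (B *m K^T)^T = B *m K^T.
    by rewrite KB !trmx_mul !trmxK !mulmxA.
  exists K^T; split => //.
  by rewrite -[X in X *m B]sKB trmx_mul trmxK -mulmxA -BK.
(* Transposing such an inverse Y of A^T makes Y^T A symmetric; the product Y^T A X1 then satisfies
   all four equations. *)
have [X1 [AX1 sX1]] := inv13 _ _ A; have [Y [AY sY]] := inv13 _ _ A^T.
have AX2 : A *m Y^T *m A = A.
  by apply: trmx_inj; rewrite !trmx_mul trmxK mulmxA.
have sX2 : (Y^T *m A)^T = Y^T *m A.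
  by rewrite -[in RHS](trmxK A) -trmx_mul sY trmx_mul trmxK.
exists (Y^T *m A *m X1); split.
- by rewrite !mulmxA AX2.
- suff: Y^T *m (A *m X1 *m A *m Y^T *m A) *m X1 = Y^T *m A *m X1.
    by rewrite !mulmxA.
  by rewrite AX1 AX2.
- by rewrite !mulmxA AX2.
- by rewrite -!mulmxA (mulmxA A) AX1.
Qed.

End Penrose.

(** * The Rayleigh quotient on N(A)^perp and the smallest nonzero eigenvalue *)

Section Rayleigh.
Variables (R : realType) (m n : nat) (A : 'M[R]_(m, n)).

Definition null_perp : set 'cV[R]_n :=
  [set e | forall y, A *m y = 0 -> dotp e y = 0].

Lemma null_perpD u v : null_perp u -> null_perp v -> null_perp (u + v).
Proof. by move=> uP vP y Ay; rewrite dotpDl uP ?vP ?addr0. Qed.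

Lemma null_perpZ c u : null_perp u -> null_perp (c *: u).
Proof. by move=> uP y Ay; rewrite dotpZl uP ?mulr0. Qed.

Lemma null_perpB u v : null_perp u -> null_perp v -> null_perp (u - v).
Proof. by move=> uP vP; rewrite -scaleN1r; exact/null_perpD/null_perpZ. Qed.

Lemma null_perp_range y : null_perp (A^T *m y).
Proof. by move=> z Az; rewrite dotp_mulmx trmxK Az dotp0r. Qed.

Lemma null_perp_eq0 u : null_perp u -> A *m u = 0 -> u = 0.
Proof. by move=> uP /uP/eqP; rewrite dotp_eq0 => /eqP. Qed.

(* The minimization is over row vectors, for which the library has Heine-Borel. *)
Lemma rayleigh_min : A != 0 ->
  exists2 e, null_perp e /\ dotp e e = 1 &
    forall v, null_perp v ->
      dotp (A *m e) (A *m e) * dotp v v <= dotp (A *m v) (A *m v).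
Proof.
move=> A0; pose q v := dotp (A *m v) (A *m v).
(* The unit sphere of N(A)^perp, written as an intersection of closed sets. *)
pose K := [set u : 'rV[R]_n | dotp u^T u^T = 1] `&`
  \bigcap_(y in nullspace A) [set u : 'rV[R]_n | (u *m y) 0 0 = 0].
have KP e : K (e^T) <-> null_perp e /\ dotp e e = 1.
  rewrite /K/= trmxK; split=> -[].
    move=> e1 eP; split=> // y Ay; exact: (eP y Ay).
  by move=> eP e1; split=> // y Ay; exact: (eP y Ay).
have unitK v : null_perp v -> v != 0 -> K ((enorm v)^-1 *: v)^T%R.
  move=> vP v0; apply/KP; split; first exact: null_perpZ.
  rewrite dotpZl dotpZr -sqr_enorm mulrA -invfM -expr2 mulVf //.
  by rewrite sqr_enorm dotp_eq0.
(* A nonzero row of A, normalized, belongs to [K] because it lies in R(A^T). *)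
have K0 : K !=set0.
  have [j Aj] : exists j, row j A != 0.
    apply: contrapT => /forallNP A'; case/negP: A0; apply/eqP/row_matrixP => j.
    by rewrite row0; apply: contrapT => /eqP /A'.
  exists ((enorm (A^T *m delta_mx j 0))^-1 *: (A^T *m delta_mx j 0))^T.
  apply: unitK; first exact: null_perp_range.
  rewrite -colE -tr_row; apply: contraNneq Aj => /(congr1 trmx).
  by rewrite trmxK linear0 => ->.
have cK : compact K.
  apply: bounded_closed_compact.
    exists 1; split => // M M1 u [/= u1 _]; apply: le_trans (ltW M1).
    rewrite [`|u|]mx_normrE; apply: bigmax_le => // -[k j] _ /=.
    rewrite ord1 -[1]sqrtr1 -u1 (le_trans _ (coord_le_enorm _ j)) //.
    by rewrite mxE.
  apply: closedI.
    apply: (@preimage_closed _ _ (fun u : 'rV[R]_n => dotp u^T u^T)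
      [set r | r = 1]); last exact: closed_eq.
    move=> u _; under eq_fun do rewrite -[_^T]mul1mx.
    exact: continuous_dotp_mulmx.
  apply: closed_bigI => y _.
  apply: (@preimage_closed _ _ (fun u : 'rV[R]_n => (u *m y) 0 0)
    [set r | r = 0]); last exact: closed_eq.
  by move=> u _; exact: continuous_mulmx_coord.
have cq : {within K, continuous (fun u : 'rV[R]_n => q u^T)}.
  exact/continuous_subspaceT/continuous_dotp_mulmx.
have [u uK umin] := EVT_min_rV K0 cK cq.
have [eP e1] : null_perp u^T /\ dotp u^T u^T = 1.
  by apply/KP; rewrite trmxK; exact: set_mem.
exists u^T => // v vP; have [->|v0] := eqVneq v 0.
  by rewrite mulmx0 !dotp0r mulr0.
have := umin _ (mem_set (unitK _ vP v0)).
rewrite /q trmxK -scalemxAr dotpZl dotpZr mulrA -invfM -expr2 sqr_enorm.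
by rewrite ler_pdivlMl ?dotp_gt0 // mulrC.
Qed.

Lemma lambda_min_gram : A != 0 ->
  0 < lambda_min (A^T *m A) /\
  forall v, null_perp v ->
    lambda_min (A^T *m A) * dotp v v <= dotp (A *m v) (A *m v).
Proof.
move=> A0; have [e [eP e1] emin] := rayleigh_min A0.
set mu := dotp (A *m e) (A *m e) in emin.
have e0 : e != 0 by rewrite -dotp_gt0 e1.
have mu0 : 0 < mu.
  by rewrite dotp_gt0; apply: contraNneq e0 => /(null_perp_eq0 eP) ->.
have eigE : A^T *m A *m e = mu *: e.
  (* The defect d of the eigenvalue equation lies in N(A)^perp, so it is an admissible direction;
     |d|^2 is half the derivative of |A v|^2 - mu |v|^2 at e along d. *)
  have [d defd] : exists d, d = A^T *m A *m e - mu *: e by eexists.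
  have dP : null_perp d.
    rewrite defd -mulmxA; apply: null_perpB; first exact: null_perp_range.
    exact: null_perpZ.
  have dE : dotp d d = dotp (A *m e) (A *m d) - mu * dotp e d.
    by rewrite {1}defd dotpBl dotpZl -mulmxA dotp_mulmx trmxK.
  (* first-order optimality of [e] in the direction [d] *)
  have small t : 0 <= (dotp (A *m e) (A *m d) - mu * dotp e d) * t *+ 2
                      + t ^+ 2 * (dotp (A *m d) (A *m d) - mu * dotp d d).
    have := emin _ (null_perpD eP (null_perpZ t dP)).
    rewrite mulmxDr -scalemxAr !(dotpDl, dotpDr, dotpZl, dotpZr) -/mu e1 -subr_ge0.
    rewrite (dotpC (A *m d) (A *m e)) (dotpC d e).
    move=> /le_trans; apply.
    by rewrite le_eqVlt; apply/orP; left; apply/eqP; ring.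
  apply/eqP; rewrite -subr_eq0 -defd -dotp_eq0; apply/eqP/le_anti.
  rewrite dotp_ge0 andbT; set c := dotp (A *m d) _ - _ in small; rewrite -dE in small.
  have c1 : 0 < c ^+ 2 + 1 by rewrite ltr_wpDl ?sqr_ge0.
  rewrite leNgt; apply/negP => dd0.
  (* For this t the quadratic in [small] equals - |d|^4 (2 (c^2 + 1) - c) / (c^2 + 1)^2, which is
     negative whatever the sign of c. *)
  have := small (- dotp d d / (c ^+ 2 + 1)).
  rewrite [X in 0 <= X](_ : _ = - (dotp d d ^+ 2 / (c ^+ 2 + 1) ^+ 2 *
    (2 * (c ^+ 2 + 1) - c))); last by field; rewrite gt_eqF.
  rewrite oppr_ge0 leNgt => /negP; apply; apply: mulr_gt0.
    by rewrite divr_gt0 ?exprn_gt0.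
  by nra.
(* [eigenvalue] refers to row vectors; A^T A being symmetric, e^T is a left eigenvector. *)
have eig : eigenvalue (A^T *m A) mu.
  apply/eigenvalueP; exists e^T; last first.
    by rewrite -(inj_eq trmx_inj) trmxK linear0.
  by apply: trmx_inj; rewrite trmx_mul !trmxK trmx_mul trmxK eigE linearZ /= trmxK.
have lower l : l != 0 -> eigenvalue (A^T *m A) l -> mu <= l.
  move=> l0 /eigenvalueP[v vl v0].
  have vlT : A^T *m A *m v^T = l *: v^T.
    by rewrite -linearZ /= -vl !trmx_mul trmxK.
  have vT0 : v^T != 0 by rewrite -(inj_eq trmx_inj) trmxK linear0.
  have vP : null_perp v^T.
    have -> : v^T = l^-1 *: (A^T *m (A *m v^T)).
      by rewrite mulmxA vlT scalerA mulVf // scale1r.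
    exact/null_perpZ/null_perp_range.
  have := emin _ vP.
  rewrite dotp_mulmx mulmxA vlT dotpZr ler_pM2r //.
  by rewrite dotp_gt0.
have -> : lambda_min (A^T *m A) = mu; last by [].
(* Two least nonzero eigenvalues bound each other, so the choice in [lambda_min] can only be mu. *)
apply: xget_subset1 => [|l1 l2 [n1 E1 m1] [n2 E2 m2]].
  by split => //; rewrite gt_eqF.
by apply/le_anti; rewrite m1 ?m2.
Qed.

End Rayleigh.

(** * The error under one orthogonal or oblique projection step *)

Lemma kaczmarz_pythagoras (R : realType) n (a e : 'cV[R]_n) : a != 0 ->
  let e' := e - (dotp a e / dotp a a) *: a in
  dotp e' e' = dotp e e - dotp a e ^+ 2 / dotp a a.
Proof.
move=> a0 /=; rewrite !(dotpBl, dotpBr, dotpZl, dotpZr) (dotpC e).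
by field; rewrite dotp_eq0.
Qed.

Section ObliqueStep.
Variables (R : realType) (n : nat) (a c e : 'cV[R]_n).
Hypotheses (a0 : a != 0) (ae0 : dotp a e = 0).

(** With a the last row used and c the new one, w is the part of c orthogonal to a, so that moving
    along w keeps the equation of a. *)
Let w := c - (dotp a c / dotp a a) *: a.
Let e' := e - (dotp c e / dotp w w) *: w.

Let aw0 : dotp a w = 0.
Proof. by rewrite dotpBr dotpZr divfK ?subrr // dotp_eq0. Qed.

Let cw : dotp c w = dotp w w.
Proof. by rewrite {2}/w dotpBl dotpZl aw0 mulr0 subr0. Qed.

Lemma oblique_gap : dotp w w = dotp c c - dotp a c ^+ 2 / dotp a a.
Proof. by rewrite -cw {1}/w dotpBr dotpZr (dotpC c a) expr2 mulrAC. Qed.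

(* Also true for [w = 0]: then [c] is a multiple of [a], and so orthogonal to [e]. *)
Let cewwK : dotp c e / dotp w w * dotp w w = dotp c e.
Proof.
have [w0|w0] := eqVneq (dotp w w) 0; last by rewrite divfK.
rewrite w0 mulr0; move/eqP: w0; rewrite dotp_eq0 subr_eq0 => /eqP cE.
by rewrite cE dotpZl ae0 mulr0.
Qed.

Lemma oblique_prev : dotp a e' = 0.
Proof. by rewrite dotpBr dotpZr aw0 mulr0 subr0. Qed.

Lemma oblique_next : dotp c e' = 0.
Proof. by rewrite dotpBr dotpZr cw cewwK subrr. Qed.

(** Since a is orthogonal to e, the vectors w and c have the same product with e, so e' is e minus
    its component along w. *)
Lemma oblique_pythagoras :
  dotp e' e' = dotp e e - dotp c e ^+ 2 / dotp w w.
Proof.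
have we : dotp w e = dotp c e by rewrite dotpBl dotpZl ae0 mulr0 subr0.
have we' : dotp w e' = 0 by rewrite dotpBr dotpZr cewwK we subrr.
rewrite {1}/e' dotpBl dotpZl we' mulr0 subr0 dotpBr dotpZr (dotpC e w) we.
by rewrite expr2 mulrAC.
Qed.

End ObliqueStep.

(** * Rows of A, their angles and Delta *)

Section Rows.
Variables (R : realType) (m n : nat) (A : 'M[R]_(m, n)).

Lemma dotp_arow j v : dotp (arow A j) v = (A *m v) j 0.
Proof. by rewrite /dotp /arow trmxK -row_mul mxE. Qed.

Lemma dotp_mulmx_rows v : dotp (A *m v) (A *m v) = \sum_j dotp (arow A j) v ^+ 2.
Proof. by rewrite dotpE; apply: eq_bigr => j _; rewrite dotp_arow expr2. Qed.

Lemma sqr_frobnorm : frobnorm A ^+ 2 = \sum_j dotp (arow A j) (arow A j).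
Proof.
rewrite /frobnorm sqr_sqrtr; last first.
  by apply: sumr_ge0 => j _; apply: sumr_ge0 => k _; rewrite sqr_ge0.
by apply: eq_bigr => j _; rewrite dotpE; apply: eq_bigr => k _; rewrite !mxE expr2.
Qed.

Lemma sin2_le_Delta j k : j != k -> sin2 A j k <= mwrko_Delta A.
Proof.
by move=> jk; rewrite /mwrko_Delta (@le_bigmax_cond _ _ _ 0 (j, k)
  (fun p => p.1 != p.2) (fun p => sin2 A p.1 p.2)).
Qed.

Lemma Delta_le1 : mwrko_Delta A <= 1.
Proof.
apply: bigmax_le => // p _; rewrite /sin2 lerBlDr lerDl.
by rewrite divr_ge0 ?sqr_ge0 // -exprMn sqr_ge0.
Qed.

Hypothesis hrow : forall j, row j A != 0.

Lemma arow_neq0 j : arow A j != 0.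
Proof. by rewrite -(inj_eq trmx_inj) trmxK linear0; exact: hrow. Qed.

Lemma dotp_arow_gt0 j : 0 < dotp (arow A j) (arow A j).
Proof. by rewrite dotp_gt0 arow_neq0. Qed.

(** Links the divisor h of the method to Delta. *)
Lemma oblique_gap_sin2 j k :
  let w := arow A k
    - (dotp (arow A j) (arow A k) / dotp (arow A j) (arow A j)) *: arow A j in
  dotp w w = dotp (arow A k) (arow A k) * sin2 A j k.
Proof.
rewrite /= oblique_gap ?arow_neq0 // /sin2 !sqr_enorm.
by field; rewrite !gt_eqF ?dotp_arow_gt0.
Qed.

(** Otherwise every sine would vanish, every row would be a multiple of the first, and the rank
    would be at most one. *)
Lemma Delta_gt0 : (1 < \rank A)%N -> 0 < mwrko_Delta A.
Proof.
move=> rA; rewrite ltNge; apply/negP => D0.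
pose j0 := Ordinal (ltnW (leq_trans rA (rank_leq_row A))).
suff : (A <= row j0 A)%MS.
  by move=> /mxrankS /leq_trans /(_ (rank_leq_row _)); rewrite leqNgt rA.
apply/row_subP => k; have [->|jk] := eqVneq j0 k; first exact: submx_refl.
have := oblique_gap_sin2 j0 k; set w := _ - _ => /= ww.
have : w == 0.
  rewrite -dotp_eq0 eq_le dotp_ge0 andbT ww pmulr_rle0 ?dotp_arow_gt0 //.
  exact: le_trans (sin2_le_Delta jk) D0.
rewrite subr_eq0 => /eqP/(congr1 trmx); rewrite linearZ /= !trmxK => ->.
exact: scalemx_sub.
Qed.

End Rows.

(** * Projection onto N(A) and the pseudoinverse solution *)

Lemma orthproj_nullspace (R : realType) m n (A : 'M[R]_(m, n)) u :
  A *m orthproj (nullspace A) u = 0 /\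
  null_perp A (u - orthproj (nullspace A) u).
Proof.
apply: (@xgetPex _ 0 [set p | nullspace A p /\
  forall y, nullspace A y -> dotp (u - p) y = 0]).
have [X [AXA _ _ sXA]] := penrose_exists A.
(* X A is the orthogonal projector onto N(A)^perp, so 1 - X A projects onto N(A). *)
exists (u - X *m A *m u); split=> [|y Ay].
  by rewrite /nullspace/= mulmxBr !mulmxA AXA subrr.
by rewrite subKr dotp_mulmx sXA -mulmxA Ay mulmx0 dotp0r.
Qed.

(** For X the pseudoinverse, consistency gives A X b = A X A xt = A xt, and symmetry of X A puts X b
    = X A xt in N(A)^perp. *)
Lemma mp_pinv_solution (R : realType) m n (A : 'M[R]_(m, n)) b xt :
  A *m xt = b ->
  A *m (mp_pinv A *m b) = b /\ null_perp A (mp_pinv A *m b).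
Proof.
move=> Axt; have := xgetPex 0 (penrose_exists A); rewrite -/(mp_pinv A).
move=> [AXA _ _ sXA]; rewrite -Axt !mulmxA AXA; split=> // y Ay.
by rewrite dotp_mulmx sXA -mulmxA Ay mulmx0 dotp0r.
Qed.

(** * The error along a run of the method *)

Section Run.
Variables (R : realType) (m n : nat) (A : 'M[R]_(m, n)) (b : 'cV[R]_m).
Hypothesis hrow : forall j, row j A != 0.
Variables (x : nat -> 'cV[R]_n) (i : nat -> 'I_m).
Hypothesis hx : mwrko A b x i.
Variable xt : 'cV[R]_n.
Hypothesis hxt : A *m xt = b.

Notation a := (arow A).
Notation lam := (lambda_min (A^T *m A)).
Notation Delta := (mwrko_Delta A).
Let e k := x k - xt.
Let M j := dotp (a j) (a j).

Let M_gt0 j : 0 < M j. Proof. exact: dotp_arow_gt0. Qed.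

Lemma residual_error k j : b j 0 - dotp (a j) (x k) = - dotp (a j) (e k).
Proof. by rewrite -hxt -dotp_arow dotpBr opprB. Qed.

Lemma error_init : e 1%N = e 0%N - (dotp (a (i 1%N)) (e 0%N) / M (i 1%N)) *: a (i 1%N).
Proof.
by rewrite /e (mwrko_init hx) residual_error sqr_enorm mulNr scaleNr addrAC.
Qed.

Lemma error_step k : (0 < k)%N ->
  let w := a (i k.+1) - (dotp (a (i k)) (a (i k.+1)) / M (i k)) *: a (i k) in
  e k.+1 = e k - (dotp (a (i k.+1)) (e k) / dotp w w) *: w.
Proof.
move=> k0; rewrite /e (mwrko_step hx k0) residual_error !sqr_enorm.
by rewrite mulNr scaleNr addrAC.
Qed.

Lemma solved_iff k : A *m x k = b <-> forall j, dotp (a j) (e k) = 0.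
Proof.
split=> [Ax j|ae]; first by rewrite dotp_arow mulmxBr Ax hxt subrr mxE.
apply/eqP; rewrite -hxt -subr_eq0 -mulmxBr; apply/eqP/matrixP => j l.
by rewrite ord1 -dotp_arow ae mxE.
Qed.

Lemma residual_argmax k j :
  dotp (a j) (e k) ^+ 2 / M j <= dotp (a (i k.+1)) (e k) ^+ 2 / M (i k.+1).
Proof.
have := mwrko_argmax hx k j; rewrite !(distrC _ (b _ 0)) !residual_error !normrN.
rewrite -(@ler_pXn2r _ 2%N) ?nnegrE ?divr_ge0 ?enorm_ge0 //.
by rewrite !expr_div_n !sqr_enorm !real_normK ?num_real.
Qed.

Lemma argmax_residual_neq0 k :
  A *m x k <> b -> dotp (a (i k.+1)) (e k) != 0.
Proof.
move=> nsol; apply/eqP => r0; apply/nsol/solved_iff => j; apply/eqP.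
have := residual_argmax k j; rewrite r0 expr0n mul0r.
by rewrite ler_pdivrMr // mul0r exprn_even_le0.
Qed.

(** The induction hypothesis supplies the orthogonality to the previous row from which the oblique
    step starts. *)
Lemma row_solved k : dotp (a (i k.+1)) (e k.+1) = 0.
Proof.
elim: k => [|k IH].
  by rewrite error_init dotpBr dotpZr divfK ?subrr // gt_eqF.
by rewrite (@error_step k.+1) // oblique_next ?arow_neq0.
Qed.

Lemma prev_row_solved k : dotp (a (i k.+1)) (e k.+2) = 0.
Proof. by rewrite (@error_step k.+1) // oblique_prev ?arow_neq0 ?row_solved. Qed.

(** The last row used has zero residual, the next one a nonzero residual; only distinct pairs enter
    Delta and gamma2. *)
Lemma argmax_neq k : A *m x k.+1 <> b -> i k.+1 != i k.+2.
Proof.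
move=> /argmax_residual_neq0; apply: contraNneq => <-.
by rewrite row_solved.
Qed.

Hypothesis e0P : null_perp A (e 0%N).

(** Each step changes the error by a combination of rows of A, which lie in R(A^T). *)
Lemma error_perp k : null_perp A (e k).
Proof.
have aP j : null_perp A (a j).
  by rewrite /arow rowE trmx_mul; exact: null_perp_range.
case: k => [//|]; elim=> [|k IH].
  by rewrite error_init; apply: null_perpB => //; exact: null_perpZ.
rewrite error_step //; apply: null_perpB => //.
by apply/null_perpZ/null_perpB => //; exact: null_perpZ.
Qed.

(** The index [i 0] witnesses that A has a row at all. *)
Lemma A_neq0 : A != 0.
Proof. by apply: contraNneq (hrow (i 0%N)) => ->; rewrite linear0. Qed.

Lemma lam_gt0 : 0 < lam.
Proof. by have [] := lambda_min_gram A_neq0. Qed.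

(* [P] selects the rows whose equations need not hold at [x k]. *)
Lemma lam_error_le k (P : pred 'I_m) :
  (forall s, ~~ P s -> dotp (a s) (e k) = 0) ->
  lam * dotp (e k) (e k) <=
    (\sum_(s | P s) M s) * (dotp (a (i k.+1)) (e k) ^+ 2 / M (i k.+1)).
Proof.
move=> nP; have [_ /(_ _ (error_perp k)) /le_trans] := lambda_min_gram A_neq0; apply.
rewrite dotp_mulmx_rows (bigID P) /= [X in _ + X]big1 ?addr0 => [|s /nP ->]; last first.
  by rewrite expr0n.
(* Each term is [M s] times a weighted squared residual, and the argmax bounds the latter. *)
rewrite mulr_suml; apply: ler_sum => s _.
by rewrite mulrC -ler_pdivrMr ?residual_argmax.
Qed.

Lemma error_decrease0 :
  dotp (e 1%N) (e 1%N) <= mwrko_rho A 0 * dotp (e 0%N) (e 0%N).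
Proof.
have F0 : 0 < frobnorm A ^+ 2.
  rewrite sqr_frobnorm (bigD1 (i 0%N)) //= ltr_wpDr ?M_gt0 //.
  by apply: sumr_ge0 => s _; rewrite ltW ?M_gt0.
have -> : dotp (e 1%N) (e 1%N) =
    dotp (e 0%N) (e 0%N) - dotp (a (i 1%N)) (e 0%N) ^+ 2 / M (i 1%N).
  by rewrite error_init kaczmarz_pythagoras ?arow_neq0.
rewrite /mwrko_rho mulrBl mul1r lerD2l lerN2 mulrAC ler_pdivrMr //.
by rewrite sqr_frobnorm [leRHS]mulrC; apply: (@lam_error_le 0%N predT).
Qed.

(** Treats both later rates, with g = gamma1 or gamma2. As the chosen row has nonzero residual, it
    is selected by [P], which gives g > 0, and it is not a multiple of the previous row, which gives
    h > 0 and Delta > 0. *)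
Lemma error_decrease k (P : pred 'I_m) g :
  (forall s, ~~ P s -> dotp (a s) (e k.+1) = 0) -> \sum_(s | P s) M s <= g ->
  A *m x k.+1 <> b ->
  [/\ 0 < g, 0 < Delta & dotp (e k.+2) (e k.+2) <=
    (1 - lam / (Delta * g)) * dotp (e k.+1) (e k.+1)].
Proof.
move=> nP Mg nsol; have rn0 := argmax_residual_neq0 nsol.
have g0 : 0 < g.
  apply: lt_le_trans Mg; rewrite (bigD1 (i k.+2)) /=.
    by rewrite ltr_wpDr ?M_gt0 ?sumr_ge0 // => s _; exact/ltW/M_gt0.
  by apply: contraNT rn0 => /nP ->.
have := oblique_gap_sin2 hrow (i k.+1) (i k.+2).
have := oblique_pythagoras (a (i k.+2)) (row_solved k).
rewrite -error_step //.
set w := a (i k.+2) - _; set r := dotp (a (i k.+2)) (e k.+1) => -> /= ww.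
have w0 : 0 < dotp w w.
  rewrite dotp_gt0; apply: contraNneq rn0 => /eqP; rewrite subr_eq0 => /eqP ->.
  by rewrite dotpZl row_solved mulr0.
have s0 : 0 < sin2 A (i k.+1) (i k.+2) by rewrite -(pmulr_rgt0 _ (M_gt0 (i k.+2))) -ww.
have sD := sin2_le_Delta A (argmax_neq nsol).
have D0 : 0 < Delta := lt_le_trans s0 sD.
split => //; rewrite mulrBl mul1r lerD2l lerN2 mulrAC ler_pdivrMr ?mulr_gt0 //.
apply: le_trans (lam_error_le nP) _.
apply: le_trans (ler_wpM2r _ Mg) _; first by rewrite divr_ge0 ?sqr_ge0 ?ltW ?M_gt0.
(* With h = M sin^2, cancelling g, M and r^2 leaves sin^2 <= Delta. *)
rewrite [leRHS]mulrA [leRHS]mulrC ler_pM2l // ww -/(M _) ler_pdivrMr //.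
rewrite [leRHS](_ : _ = r ^+ 2 * Delta / sin2 A (i k.+1) (i k.+2)).
  by rewrite ler_pdivlMr // ler_wpM2l ?sqr_ge0.
by field; rewrite !gt_eqF.
Qed.

Lemma error_decrease1 : A *m x 1%N <> b ->
  dotp (e 2%N) (e 2%N) <= mwrko_rho A 1 * dotp (e 1%N) (e 1%N).
Proof.
move=> nsol.
have [||//] := @error_decrease 0%N (fun s => s != i 1%N) (mwrko_gamma1 A) _ _ nsol.
  by move=> s; rewrite negbK => /eqP ->; rewrite row_solved.
rewrite /mwrko_gamma1 (bigmax_sup (i 1%N)) //.
by apply: ler_sum => s _; rewrite sqr_enorm.
Qed.

(** The first assumption makes the last two rows distinct, so that their pair is counted in gamma2.
    The positivity is kept to show that the rate is below 1. *)
Lemma error_decrease2 k : A *m x k.+1 <> b -> A *m x k.+2 <> b ->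
  [/\ 0 < mwrko_gamma2 A, 0 < Delta & dotp (e k.+3) (e k.+3) <=
    mwrko_rho A k.+2 * dotp (e k.+2) (e k.+2)].
Proof.
move=> nsol1 nsol2.
apply: (@error_decrease k.+1 (fun s => (s != i k.+1) && (s != i k.+2))) => //.
  move=> s; rewrite negb_and !negbK => /orP[]/eqP->.
    by rewrite prev_row_solved.
  by rewrite row_solved.
rewrite /mwrko_gamma2 (bigmax_sup (i k.+1, i k.+2)) ?argmax_neq //=.
by apply: ler_sum => s _; rewrite sqr_enorm.
Qed.

Lemma error_decrease_rho k : (forall j, (j <= k)%N -> A *m x j <> b) ->
  dotp (e k.+1) (e k.+1) <= mwrko_rho A k * dotp (e k) (e k).
Proof.
case: k => [|[|k]] nsol; first exact: error_decrease0.
  by apply: error_decrease1; exact: nsol.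
by have [] := error_decrease2 (nsol k.+1 (leqnSn _)) (nsol k.+2 (leqnn _)).
Qed.

Lemma error_gt0 k : A *m x k <> b -> 0 < dotp (e k) (e k).
Proof.
move=> nsol; rewrite dotp_gt0; apply/eqP => /eqP; rewrite subr_eq0 => /eqP xk.
by apply: nsol; rewrite xk.
Qed.

(** The rate bounds a quotient of squared errors whose denominator is positive as long as no
    solution is reached; its sign is what lets the bounds be multiplied. *)
Lemma rho_ge0 k : (forall j, (j <= k)%N -> A *m x j <> b) -> 0 <= mwrko_rho A k.
Proof.
move=> nsol; rewrite -(pmulr_lge0 _ (error_gt0 (nsol k (leqnn k)))).
exact: le_trans (dotp_ge0 _) (error_decrease_rho nsol).
Qed.

Lemma error_bound k : (forall j, (j < k)%N -> A *m x j <> b) ->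
  dotp (e k) (e k) <= (\prod_(0 <= s < k) mwrko_rho A s) * dotp (e 0%N) (e 0%N).
Proof.
elim: k => [|k IH] nsol; first by rewrite big_geq // mul1r.
rewrite big_nat_recr //= mulrAC [leRHS]mulrC.
apply: le_trans (error_decrease_rho nsol) _.
by rewrite ler_wpM2l ?rho_ge0 // IH // => j /ltnW; exact: nsol.
Qed.

(** An error in both N(A) and N(A)^perp is zero, and every step fixes a zero error. *)
Lemma solved_stable j k : (j <= k)%N -> A *m x j = b -> x k = xt.
Proof.
move=> /subnK <- Axj; apply/eqP; rewrite -subr_eq0 -/(e _).
have ej : e j = 0.
  by apply: (null_perp_eq0 (error_perp j)); rewrite mulmxBr Axj hxt subrr.
elim: (k - j)%N => [|l /eqP IH]; first by rewrite ej.
(* Index 0 is the initial step, which has its own formula. *)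
rewrite addSn; case: (l + j)%N IH => [|l'] IH.
  by rewrite error_init IH dotp0r mul0r scale0r subr0.
by rewrite error_step // IH dotp0r mul0r scale0r subr0.
Qed.

(** Either some iterate is a solution and the sequence is constant from there on, or the squared
    errors decay geometrically from index 2 on, where the rate no longer depends on k. *)
Lemma iterates_cvg : x k @[k --> \oo] --> xt.
Proof.
have [[j Axj]|nsol] := pselect (exists j, A *m x j = b).
  apply: cvg_near_cst; near=> k; apply: solved_stable Axj.
  by near: k; exact: nbhs_infty_ge.
have {}nsol j : A *m x j <> b by move=> Axj; apply: nsol; exists j.
set rho := mwrko_rho A 2.
have rho0 : 0 <= rho by exact: rho_ge0.
have rho1 : rho < 1.
  have [g0 D0 _] := error_decrease2 (nsol 1%N) (nsol 2).
  by rewrite /rho /= ltrBlDr ltrDl divr_gt0 ?mulr_gt0 ?lam_gt0.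
have bound k : dotp (e k.+2) (e k.+2) <= dotp (e 2) (e 2) * rho ^+ k.
  elim: k => [|k IH]; first by rewrite expr0 mulr1.
  apply: le_trans (@error_decrease_rho k.+2 _) _ => //.
  by rewrite exprS mulrCA ler_wpM2l.
rewrite -(cvg_shiftn 2); apply/cvgrPdist_le => eps eps0.
have arho : `|rho| < 1 by rewrite ger0_norm.
(* The decay concerns squared norms, hence the tolerance eps^2. *)
have /cvgrPdist_le/(_ _ (exprn_gt0 2 eps0)) :=
  cvg_geometric (dotp (e 2) (e 2)) arho.
apply: filterS => k; rewrite sub0r normrN => /(le_trans (ler_norm _)) gk.
rewrite /= addn2 -normrN opprB (le_trans (mx_norm_le_enorm _)) //.
rewrite -(@ler_pXn2r _ 2%N) ?nnegrE ?enorm_ge0 ?(ltW eps0) // sqr_enorm.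
exact: le_trans (bound k) gk.
Unshelve. all: end_near. Qed.

End Run.

(** * The error bound and the least-norm limit *)

Theorem theorem2 (R : realType) (m n : nat) (A : 'M[R]_(m, n)) (b : 'cV[R]_m)
    (hrow : forall i : 'I_m, row i A != 0)
    (x : nat -> 'cV[R]_n) (i : nat -> 'I_m) (hx : mwrko A b x i)
    (xt : 'cV[R]_n) (hxt : A *m xt = b)
    (hproj : orthproj (nullspace A) xt = orthproj (nullspace A) (x 0%N)) :
  [/\ ((1 < \rank A)%N -> 0 < mwrko_Delta A) /\ mwrko_Delta A <= 1,
      (forall k : nat, (forall j : nat, (j < k)%N -> A *m x j <> b) ->
        enorm (x k - xt) ^+ 2
          <= (\prod_(0 <= s < k) mwrko_rho A s) * enorm (x 0%N - xt) ^+ 2),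
      (forall j k : nat, (j <= k)%N -> A *m x j = b -> x k = xt) &
      (rangespace A^T (x 0%N) ->
        least_norm_solution A b (mp_pinv A *m b) /\
        x k @[k --> \oo] --> mp_pinv A *m b)].
Proof.
(* The equal projections onto N(A) cancel, so the initial error is a difference of two vectors of
   N(A)^perp. *)
have e0P : null_perp A (x 0%N - xt).
  have [_ xtP] := orthproj_nullspace A xt.
  have [_ x0P] := orthproj_nullspace A (x 0%N).
  by have := null_perpB x0P xtP; rewrite -hproj opprB addrA subrK.
split.
- by split; [exact: Delta_gt0 | exact: Delta_le1].
- by move=> k nsol; rewrite !sqr_enorm; exact: (error_bound hrow hx hxt e0P).
- by move=> j k; exact: (solved_stable hx hxt e0P).
move=> [y _ x0y]; have [bE bP] := mp_pinv_solution hxt.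
(* Both are solutions in N(A)^perp, the first because [x 0] lies in R(A^T); their difference also
   lies in N(A), hence is zero. *)
have xtE : xt = mp_pinv A *m b.
  apply/eqP; rewrite -subr_eq0; apply/eqP/(@null_perp_eq0 _ _ _ A); last first.
    by rewrite mulmxBr hxt bE subrr.
  apply: null_perpB => //; rewrite -[xt](subKr (x 0%N)); apply: null_perpB => //.
  by rewrite -x0y; exact: null_perp_range.
split; last by rewrite -xtE; exact: (iterates_cvg hrow hx hxt e0P).
split=> // z Az; rewrite -(@ler_pXn2r _ 2%N) ?nnegrE ?enorm_ge0 // !sqr_enorm.
(* Any solution z is the pseudoinverse solution plus an element of N(A), which is orthogonal to it;
   Pythagoras gives minimality. *)
have perp : dotp (mp_pinv A *m b) (z - mp_pinv A *m b) = 0.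
  by apply: bP; rewrite mulmxBr Az bE subrr.
move: perp (subrK (mp_pinv A *m b) z); move: (z - _) => d perp <-.
rewrite dotpDl !dotpDr (dotpC d) perp add0r addr0.
by rewrite lerDr dotp_ge0.
Qed.
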